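(* Let $p$ be a prime and let $(\mathcal{A}_p,f)$ be a connected affine quandle of order $p$, where $f(x)=tx$ on $\mathbb{Z}_p$ and $n$ is the order of $f$. Then $$|\mathcal{A}_p\otimes\mathcal{A}_p|=1+\frac{p-1}{n}.$$
   Context: A quandle is a set $X$ with a binary operation $\triangleright$ such that $x\triangleright x=x$; for all $x,y$ there is a unique $z$ with $x=z\triangleright y$ (this $z$ is denoted $x\triangleright^{-1}y$); and $(x\triangleright y)\triangleright z=(x\triangleright z)\triangleright(y\triangleright z)$. $Inn(X)$ is the group of permutations of $X$ generated by the maps $R_y(x)=x\triangleright y$; $X$ is connected if $Inn(X)$ acts transitively on $X$. For $t\in\mathbb{Z}_p^{\ast}$ and $f(x)=tx$, $(\mathcal{A}_p,f)$ is the affine quandle on $\mathbb{Z}_p$ with $x\triangleright y=tx+(1-t)y$; the order $n$ of $f$ is the least $n\in\mathbb{N}$ with $t^n\equiv1\pmod p$. Let $F(X)$ be the free group on the set $X$. It acts on $X$ on the right by $x\cdot g=((x\triangleright^{\epsilon_1}x_1)\triangleright^{\epsilon_2}x_2\cdots)\triangleright^{\epsilon_m}x_m$ for $g=x_1^{\epsilon_1}\cdots x_m^{\epsilon_m}$ with $\epsilon_i=\pm1$, $\triangleright^{1}=\triangleright$, and on the left by $g\cdot x=x\cdot g^{-1}$. The (canonical) tensor product $X\otimes X$ is the set of equivalence classes $[(x,y)]$ of $X\times X$ under the equivalence relation generated by $(x\cdot g,y)\sim(x,g\cdot y)$ for $x,y\in X$, $g\in F(X)$. Equivalently, $X\otimes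 X$ is the set of orbits of $Inn(X)$ acting diagonally on $X\times X$. *)

(* Defs.v *)
From HB Require Import structures.
From mathcomp Require Import all_boot all_order all_algebra all_fingroup.
From mathcomp Require Import boolp.
From Stdlib Require Import Relations.

Set Implicit Arguments.
Unset Strict Implicit.
Unset Printing Implicit Defensive.

Import GRing.Theory.

HB.mixin Record isQuandle X := {
  qop : X -> X -> X;
  qopxx : forall x, qop x x = x;
  qop_unique : forall x y, exists! z, x = qop z y;
  qopD : forall x y z, qop (qop x y) z = qop (qop x z) (qop y z)
}.

#[short(type="quandleType")]
HB.structure Definition Quandle := {X of isQuandle X & Choice X}.

#[short(type="finQuandleType")]
HB.structure Definition FinQuandle := {X of isQuandle X & Finite X}.

Declare Scope quandle_scope.
Local Open Scope quandle_scope.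

Notation "x |> y" := (qop x y)
  (at level 40, left associativity) : quandle_scope.

Lemma qinv_ex (X : quandleType) (x y : X) : exists z, x == z |> y.
Proof. by have [z [-> _]] := qop_unique x y; exists z. Qed.

Definition qinv (X : quandleType) (x y : X) : X := xchoose (qinv_ex x y).

Notation "x |>^-1 y" := (qinv x y)
  (at level 40, left associativity) : quandle_scope.

Lemma qopI (X : quandleType) (y : X) : injective (fun x : X => x |> y).
Proof.
move=> x x' e; have [z [_ zP]] := qop_unique (x |> y) y.
by rewrite -(zP x erefl) -(zP x' e).
Qed.

Definition Rperm (X : finQuandleType) (y : X) : {perm X} := perm (@qopI X y).

Definition Inn (X : finQuandleType) : {group {perm X}} :=
  <<[set Rperm y | y : X]>>%G.

Definition connected (X : finQuandleType) : bool :=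
  [transitive Inn X, on [set: X] | 'P]%g.

(* Elements of the free group are represented by their unique reduced words. *)
Section FreeGroup.
Variable X : choiceType.

(* (x, true) stands for x and (x, false) for its inverse *)
Definition letter := (X * bool)%type.
Implicit Types (a b : letter) (w u v : seq letter).

Definition flip a : letter := (a.1, ~~ a.2).

Fixpoint reduced w : bool :=
  if w is a :: w' then (ohead w' != Some (flip a)) && reduced w' else true.

Record free_group := FreeWord { word :> seq letter; wordP : reduced word }.

HB.instance Definition _ := [isSub for word].
HB.instance Definition _ := [Choice of free_group by <:].

Definition push a w : seq letter :=
  if w is b :: w' then (if b == flip a then w' else a :: w) else [:: a].

Lemma flipK : involutive flip.
Proof. by case=> x e; rewrite /flip negbK. Qed.

Lemma reduced_push a w : reduced w -> reduced (push a w).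
Proof.
case: w => [|b w] //= /andP[hb rw]; case: eqP => [//|/eqP nb] /=.
by rewrite rw hb !andbT (inj_eq Some_inj).
Qed.

Lemma reduced_foldr u w : reduced w -> reduced (foldr push w u).
Proof. by move=> rw; elim: u => //= a u IH; apply: reduced_push. Qed.

Lemma pushK a w : reduced w -> push a (push (flip a) w) = w.
Proof.
case: w => [|b w] /=; first by rewrite eqxx.
case/andP=> hb rw; rewrite flipK; case: eqP => [eb|_] /=; last by rewrite eqxx.
subst b; case: w hb rw => [|c w] //= hc _.
by move: hc; rewrite (inj_eq Some_inj) => /negbTE ->.
Qed.

Lemma pushKV a w : reduced w -> push (flip a) (push a w) = w.
Proof. by move=> rw; rewrite -{2}(flipK a) pushK. Qed.

Lemma foldr_push_id w : reduced w -> foldr push [::] w = w.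
Proof.
elim: w => //= a w IH /andP[ha rw]; rewrite IH //.
by case: w ha {IH rw} => //= b w; rewrite (inj_eq Some_inj) => /negbTE ->.
Qed.

Lemma foldr_push_push a u w :
  reduced w -> foldr push w (push a u) = push a (foldr push w u).
Proof.
move=> rw; case: u => [|b u] //=; case: eqP => [->|//].
by rewrite pushK // reduced_foldr.
Qed.

Lemma foldr_push_foldr u v w : reduced w ->
  foldr push w (foldr push v u) = foldr push (foldr push w v) u.
Proof. by move=> rw; elim: u => //= a u IH; rewrite foldr_push_push // IH. Qed.

Definition inv_word w : seq letter := rev (map flip w).

Lemma inv_wordK : involutive inv_word.
Proof. by move=> w; rewrite /inv_word map_rev revK mapK //; apply: flipK. Qed.

Lemma foldr_inv_word u w : reduced w ->
  foldr push (foldr push w u) (inv_word u) = w.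
Proof.
move=> rw; elim: u => //= a u IH.
rewrite /inv_word /= rev_cons -cats1 foldr_cat /= pushKV ?IH //.
exact: reduced_foldr.
Qed.

Lemma reduced_rcons w a :
  reduced w -> ohead (rev w) != Some (flip a) -> reduced (rcons w a).
Proof.
elim: w => //= b w IH /andP[hb rw].
rewrite rev_cons; case: (lastP w) hb rw IH => [|w' c] hb rw IH ha /=.
  move: ha; rewrite /= !(inj_eq Some_inj) andbT => ha.
  by apply: contra ha => /eqP ->; rewrite flipK.
rewrite IH //; last by move: ha; rewrite rev_rcons.
by rewrite andbT; case: (w') hb.
Qed.

Lemma reduced_inv w : reduced w -> reduced (inv_word w).
Proof.
elim: w => //= a w IH /andP[ha rw]; rewrite /inv_word /= rev_cons.
apply: reduced_rcons; first exact: IH.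
rewrite revK; case: w ha {IH rw} => //= b w.
by rewrite !(inj_eq Some_inj) (inj_eq (can_inj flipK)).
Qed.

Definition free_one := @FreeWord [::] isT.
Definition free_mul (u v : free_group) :=
  FreeWord (reduced_foldr u (wordP v)).
Definition free_inv (u : free_group) := FreeWord (reduced_inv (wordP u)).

Lemma free_mulA : associative free_mul.
Proof.
by move=> u v w; apply: val_inj; rewrite /= foldr_push_foldr // wordP.
Qed.

Lemma free_mul1g : left_id free_one free_mul.
Proof. by move=> u; apply: val_inj. Qed.

Lemma free_mulg1 : right_id free_one free_mul.
Proof. by move=> u; apply: val_inj; rewrite /= foldr_push_id // wordP. Qed.

Lemma free_mulVg : left_inverse free_one free_inv free_mul.
Proof.
move=> u; apply: val_inj => /=.
by rewrite -{1}(foldr_push_id (wordP u)) foldr_inv_word.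
Qed.

Lemma free_mulgV : right_inverse free_one free_inv free_mul.
Proof.
by move=> u; rewrite -[X in free_mul X _](_ : free_inv (free_inv u) = u)
  ?free_mulVg //; apply: val_inj; rewrite /= inv_wordK.
Qed.

HB.instance Definition _ := isGroup.Build free_group
  free_mulA free_mul1g free_mulg1 free_mulVg free_mulgV.

End FreeGroup.

Section Tensor.
Variable X : quandleType.
Implicit Types (x y : X) (g : free_group X) (a b : X * X).

Definition act_letter x (l : letter X) : X :=
  if l.2 then x |> l.1 else x |>^-1 l.1.

Definition ract x g : X := foldl act_letter x (word g).

Definition lact g x : X := ract x (g^-1)%g.

Definition tensor_gen a b : Prop :=
  exists x y g, a = (ract x g, y) /\ b = (x, lact g y).

Definition tensor_equiv : relation (X * X) :=
  clos_refl_sym_trans (X * X) tensor_gen.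

End Tensor.

Definition tensor (X : finQuandleType) : {set {set X * X}} :=
  equivalence_partition (fun a b => `[< tensor_equiv a b >]) [set: X * X].

Section Affine.
Local Open Scope ring_scope.

(* 'F_p is Z/p for prime p; t ranges over its units. *)
Definition affine (p : nat) (t : {unit 'F_p}) : Type := 'F_p.

Variables (p : nat) (t : {unit 'F_p}).

HB.instance Definition _ := Finite.on (affine t).

Definition affine_op (x y : affine t) : affine t :=
  (val t * (x : 'F_p) + (1 - val t) * (y : 'F_p) : 'F_p).

Lemma affine_opxx x : affine_op x x = x.
Proof. by rewrite /affine_op -mulrDl subrKC mul1r. Qed.

Lemma affine_op_unique x y : exists! z, x = affine_op z y.
Proof.
have tU := valP t; exists ((val t)^-1 * ((x : 'F_p) - (1 - val t) * (y : 'F_p))).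
split; first by rewrite /affine_op mulVKr // subrK.
by move=> z ->; rewrite /affine_op addrK mulKr.
Qed.

Lemma affine_opD x y z :
  affine_op (affine_op x y) z = affine_op (affine_op x z) (affine_op y z).
Proof.
rewrite /affine_op; set s : 'F_p := val t.
rewrite !mulrDr !mulrA (mulrC (1 - s) s) -!addrA; congr (_ + _).
rewrite [RHS]addrCA; congr (_ + _).
by rewrite -mulrDl -mulrDl subrKC mul1r.
Qed.

HB.instance Definition _ :=
  isQuandle.Build (affine t) affine_opxx affine_op_unique affine_opD.

End Affine.

(* Main.v *)
Require Import Defs.
From mathcomp Require Import all_boot all_order all_algebra all_fingroup.
From mathcomp Require Import cyclic boolp ring.
From Stdlib Require Import Relations.

(** Acting on both components of a pair by the same element of [F(X)] does not
    change its class in the tensor square, and for the affine quandle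
    [x |> y = t x + (1 - t) y] such an action multiplies the difference of the
    two components by a power of [t].  Conversely, connectedness forces
    [t != 1]; then compositions of [_ |> z] and the inverse of [_ |> 0] give
    all translations, and so every pair [(x, y)] can be moved to [(x - y, 0)],
    whose first component can be scaled by [t] through the action of [0].  Thus
    two pairs are equivalent exactly when their differences lie in the same
    orbit of [<[t]>] acting on [F_p] by multiplication
    ([affine_tensor_equivP]).

    The classes are then counted by size: the diagonal is one class with [p]
    elements, and since nonzero differences have trivial stabiliser every other
    class has [p * #[t]] elements.  Hence a tensor square with [N] classes
    satisfies [p ^ 2 = p + (N - 1) * (p * #[t])]. *)

Set Implicit Arguments.
Unset Strict Implicit.
Unset Printing Implicit Defensive.

Import GRing.Theory.

Local Open Scope quandle_scope.

(** * The tensor equivalence as the diagonal action *)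

Section DiagonalAction.
Variable X : quandleType.
Implicit Types (x y z : X) (l : letter X) (w : seq (letter X)).

Lemma qinvK x y : (x |>^-1 y) |> y = x.
Proof. by rewrite -(eqP (xchooseP (qinv_ex x y))). Qed.

Lemma qopK x y : (x |> y) |>^-1 y = x.
Proof. by apply: (@qopI _ y); rewrite qinvK. Qed.

Lemma act_letterK l x : act_letter (act_letter x l) (flip l) = x.
Proof. by case: l => z [] /=; [apply: qopK | apply: qinvK]. Qed.

Lemma foldl_act_inv_word w x :
  foldl (@act_letter X) (foldl (@act_letter X) x (inv_word w)) w = x.
Proof.
elim: w x => //= l w IH x.
rewrite /inv_word /= rev_cons foldl_rcons -[X in act_letter _ X]flipK.
by rewrite act_letterK IH.
Qed.

Lemma ract_lact (g : free_group X) y : Defs.ract (lact g y) g = y.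
Proof. exact: foldl_act_inv_word. Qed.

(** The balancing relation [(x . g, y) ~ (x, g . y)] says, after the change of
    variable [y := y' . g], that simultaneous moves stay within a class. *)
Lemma tensor_equiv_qop x y z : tensor_equiv (x |> z, y |> z) (x, y).
Proof.
apply: rst_step; exists x, (y |> z), (FreeWord (isT : reduced [:: (z, true)])).
by split=> //; rewrite /lact /Defs.ract /= /act_letter /= qopK.
Qed.

End DiagonalAction.

(** * Classes of the affine quandle *)

Section AffineTensor.
Local Open Scope ring_scope.
Variables (p : nat) (p_prime : prime p) (t : {unit 'F_p}).
Implicit Types (a b : affine t * affine t) (w : seq (letter (affine t))).

Definition diff a : 'F_p := (a.1 : 'F_p) - (a.2 : 'F_p).

Lemma affine_qopE (x y : affine t) :
  x |> y = (val t * (x : 'F_p) + (1 - val t) * (y : 'F_p) : 'F_p).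
Proof. by []. Qed.

Lemma diff_qop (x y z : affine t) : diff (x |> z, y |> z) = val t * diff (x, y).
Proof. by rewrite /diff /= !affine_qopE opprD addrACA subrr addr0 mulrBr. Qed.

Lemma diff_act (l : letter (affine t)) (x y : affine t) :
  exists2 u : {unit 'F_p}, u \in <[t]>%g &
    diff (act_letter x l, act_letter y l) = val u * diff (x, y).
Proof.
case: l => z [] /=; first by exists t; rewrite ?cycle_id //; apply: diff_qop.
exists t^-1%g; first by rewrite groupV cycle_id.
rewrite -{2}(qinvK x z) -{2}(qinvK y z) diff_qop FinRing.val_unitV.
by rewrite mulKr ?(valP t).
Qed.

Lemma diff_foldl_act w (x y : affine t) :
  exists2 u : {unit 'F_p}, u \in <[t]>%g &
    diff (foldl (@act_letter _) x w, foldl (@act_letter _) y w)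
      = val u * diff (x, y).
Proof.
elim: w x y => [|l w IH] x y /=; first by exists 1%g; rewrite ?group1 ?mul1r.
have [u ut ->] := IH (act_letter x l) (act_letter y l).
have [v vt ->] := diff_act l x y.
by exists (u * v)%g; rewrite ?groupM // FinRing.val_unitM mulrA.
Qed.

Definition diff_orbit a b : Prop :=
  exists2 u : {unit 'F_p}, u \in <[t]>%g & diff a = val u * diff b.

Lemma tensor_equiv_diff a b : tensor_equiv a b -> diff_orbit a b.
Proof.
elim=> {a b} [_ _ [x [y [g [-> ->]]]] | a | a b _ [u ut e]
  | a b c _ [u ut e] _ [v vt f]].
- by rewrite -{1}(ract_lact g y); apply: diff_foldl_act.
- by exists 1%g; rewrite ?group1 // mul1r.
- by exists u^-1%g; rewrite ?groupV // e FinRing.val_unitV mulKr ?(valP u).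
- by exists (u * v)%g; rewrite ?groupM // e f FinRing.val_unitM mulrA.
Qed.

(** All the maps [_ |> y] are the identity when [t = 1], whereas the quandle
    has at least two elements. *)
Lemma connected_neq1 : connected (affine t) -> val t != 1.
Proof.
move=> conn; apply/eqP => t1.
have Inn1 : Inn (affine t) \subset [1 {perm affine t}]%g.
  rewrite gen_subG; apply/subsetP => _ /imsetP[y _ ->]; rewrite inE.
  apply/eqP/permP => x; rewrite permE perm1 affine_qopE t1.
  by rewrite subrr mul0r addr0 mul1r.
have [s sI] := atransP2 conn (in_setT (0 : 'F_p)) (in_setT (1 : 'F_p)).
move/(subsetP Inn1): sI; rewrite inE => /eqP-> /=.
by rewrite /aperm perm1 => /eqP; rewrite oner_eq0.
Qed.

Hypothesis conn : connected (affine t).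

Lemma tensor_equiv_translate (x y c : 'F_p) :
  tensor_equiv ((x + c, y + c) : affine t * affine t) (x, y).
Proof.
have t1 : 1 - val t != 0 by rewrite subr_eq0 eq_sym connected_neq1.
(* [z] is the solution of [x |> z = (x + c) |> 0], the same for every [x]. *)
pose z : 'F_p := val t * c / (1 - val t).
have shift (v : 'F_p) :
    (v : affine t) |> (z : affine t)
      = ((v + c : 'F_p) : affine t) |> ((0 : 'F_p) : affine t).
  by rewrite !affine_qopE /z mulrC; field.
apply: rst_trans (tensor_equiv_qop (x : affine t) y z).
by rewrite !shift; apply: rst_sym; apply: tensor_equiv_qop.
Qed.

Lemma tensor_equiv_scale (d : 'F_p) k :
  tensor_equiv ((val t ^+ k * d, 0) : affine t * affine t) (d, 0).
Proof.
elim: k => [|k IH]; first by rewrite mul1r; apply: rst_refl.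
apply: rst_trans IH.
have := tensor_equiv_qop ((val t ^+ k * d : 'F_p) : affine t)
  (0 : 'F_p) (0 : 'F_p).
by rewrite qopxx affine_qopE mulr0 addr0 mulrA -exprS.
Qed.

(** Both pairs are first translated to second component [0]; scaling by [t]
    then connects the results. *)
Lemma affine_tensor_equivP a b : tensor_equiv a b <-> diff_orbit a b.
Proof.
split; first exact: tensor_equiv_diff.
have norm c : tensor_equiv c (diff c, 0 : 'F_p).
  case: c => x y; have := tensor_equiv_translate (diff (x, y)) 0 y.
  by rewrite add0r /diff subrK.
case=> u /cycleP[k ->] e; apply: rst_trans (norm a) _.
apply: rst_trans (rst_sym _ _ _ _ (norm b)).
by rewrite e FinRing.val_unitX; apply: tensor_equiv_scale.
Qed.

(** * Counting the classes *)

Definition tensor_class a : {set affine t * affine t} :=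
  [set b | `[< tensor_equiv a b >]].

Lemma tensor_partition :
  partition (tensor (affine t)) [set: affine t * affine t].
Proof.
apply: equivalence_partitionP => a b c _ _ _.
split; first by apply/asboolP; apply: rst_refl.
move=> /asboolP ab; apply/asboolP/asboolP; last exact: rst_trans.
by apply: rst_trans; apply: rst_sym.
Qed.

Lemma mem_tensorP A :
  reflect (exists a, A = tensor_class a) (A \in tensor (affine t)).
Proof.
apply: (iffP imsetP) => [[a _ ->]|[a ->]]; exists a => //; apply/setP=> b;
  by rewrite !inE.
Qed.

(** This parametrisation reduces the size of a class to the question of how
    many elements of [<[t]>] fix the difference of [a]. *)
Lemma tensor_class_image a :
  tensor_class a =
  [set ((v.1 + val v.2 * diff a, v.1) : affine t * affine t)
    | v in setX [set: 'F_p] <[t]>%g].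
Proof.
apply/setP=> -[x y]; rewrite inE; apply/asboolP/imsetP.
  move=> /(@rst_sym _ _ _ _)/(affine_tensor_equivP _ _).1 [u ut e].
  exists (y : 'F_p, u).
    by rewrite !inE.
  by rewrite /= -e /diff /= addrC subrK.
case=> -[v u] /setXP[_ /= ut] [-> ->]; apply: rst_sym.
by apply/affine_tensor_equivP; exists u; rewrite // /diff /= addrC addKr.
Qed.

(** For a nonzero difference the parametrisation of [tensor_class_image] is
    injective, because [F_p] has no zero divisors. *)
Lemma card_tensor_class a : diff a != 0 -> #|tensor_class a| = (p * #[t]%g)%N.
Proof.
move=> d0; rewrite tensor_class_image card_imset.
  by rewrite cardsX cardsT card_Fp.
case=> v u [v' u'] /= /pair_equal_spec[e ev]; move: e; rewrite ev.
by move=> /(@addrI 'F_p)/(mulIf d0)/val_inj ->.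
Qed.

Lemma card_tensor_class_diag a : diff a = 0 -> #|tensor_class a| = p.
Proof.
move=> d0.
have -> : tensor_class a =
  [set ((v, v) : affine t * affine t) | v in [set: 'F_p]].
  rewrite tensor_class_image d0; apply/setP => b; apply/imsetP/imsetP.
    by case=> -[v u] _ ->; exists v; rewrite // mulr0 addr0.
  by case=> v _ ->; exists (v, 1%g); rewrite ?inE ?group1 //= mulr0 addr0.
by rewrite card_imset ?cardsT ?card_Fp // => v v' /pair_equal_spec[].
Qed.

(** The class equation [p ^ 2 = p + (N - 1) * (p * #[t])], divided by [p]. *)
Lemma card_tensor_affine : p = (#|tensor (affine t)|.-1 * #[t]%g).+1.
Proof.
pose D := tensor_class (0 : 'F_p, 0 : 'F_p).
have DT : D \in tensor (affine t) by apply/mem_tensorP; eexists.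
have := card_partition tensor_partition.
rewrite (big_setD1 D) //= card_tensor_class_diag; last exact: subrr.
rewrite (eq_bigr (fun=> p * #[t]%g)%N) => [|A].
  rewrite sum_nat_const cardsT card_prod card_Fp // (cardsD1 D (tensor _)).
  rewrite DT add1n /=; set m := #|_| => e; apply/eqP.
  by rewrite -(eqn_pmul2l (prime_gt0 p_prime)) e mulnS mulnCA.
rewrite in_setD1 => /andP[AD /mem_tensorP[a Aa]]; subst A.
apply: card_tensor_class; apply: contraNneq AD => d0.
by rewrite /D !tensor_class_image d0 /diff /= subrr.
Qed.

Lemma tensor_affine_gt0 : (0 < #|tensor (affine t)|)%N.
Proof.
apply/card_gt0P; exists (tensor_class (0 : 'F_p, 0 : 'F_p)).
by apply/mem_tensorP; eexists.
Qed.

End AffineTensor.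

Local Open Scope ring_scope.

Theorem theorem7p4 (p : nat) (p_prime : prime p) (t : {unit 'F_p})
    (conn : connected (affine t))
    (n : nat) (n_gt0 : (0 < n)%N) (t_order : val t ^+ n = 1)
    (n_least : forall m : nat, (0 < m)%N -> val t ^+ m = 1 -> (n <= m)%N) :
  #|tensor (affine t)|%:R = 1 + (p%:R - 1) / n%:R :> rat.
Proof.
have -> : n = #[t]%g.
  apply/eqP; rewrite eqn_leq n_least ?order_gt0 //=; last first.
    by rewrite -FinRing.val_unitX expg_order.
  apply: dvdn_leq => //; rewrite order_dvdn; apply/eqP/val_inj.
  by rewrite FinRing.val_unitX.
have n0 : #[t]%g%:R != 0 :> rat by rewrite Num.Theory.pnatr_eq0 -lt0n order_gt0.
have /(congr1 (fun k => k%:R : rat)) -> := card_tensor_affine p_prime conn.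
rewrite -natr1 addrK natrM mulfK //.
by rewrite nat1r prednK ?tensor_affine_gt0.
Qed.
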